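(* Let $X$ be a topological space and let $f\in\mathcal{M}(X,\mathbb{R})$. A filter $\mathcal{F}$ on $\mathcal{M}(X,\mathbb{R})$ order converges to $f$ if and only if $\mathcal{F}\in\lambda(f)$, i.e. if and only if $\{f\}=\bigcap\{[g]: g:X\to\mathbb{R}\text{ usco},\ [g]\in\mathcal{F}\}$.
   Context: A set-valued map $g:X\to\mathbb{R}$ is usco if $g(x)$ is a nonempty compact subset of $\mathbb{R}$ for each $x\in X$ and $\{x\in X: g(x)\subset U\}$ is open in $X$ for each open $U\subset\mathbb{R}$. Set-valued maps are identified with their graphs, so $h\subset g$ means $h(x)\subset g(x)$ for all $x\in X$. A usco map $g$ is minimal if $h=g$ for every usco $h$ with $h\subset g$. $\mathcal{M}(X,\mathbb{R})$ is the set of all minimal usco maps from $X$ to $\mathbb{R}$. For a usco map $g$, $[g]=\{f\in\mathcal{M}(X,\mathbb{R}): f\subset g\}$. $\lambda(f)$ is the set of filters $\mathcal{F}$ on $\mathcal{M}(X,\mathbb{R})$ converging to $f$, i.e. such that $\{f\}=\bigcap\{[g]: g \text{ usco},\ [g]\in\mathcal{F}\}$ (in particular at least one usco $g$ with $[g]\in\mathcal{F}$ is required to exist). For $f\in\mathcal{M}(X,\mathbb{R})$ let $\underline{f}(x)=\min f(x)$ and $\overline{f}(x)=\max f(x)$. The partial order on $\mathcal{M}(X,\mathbb{R})$ is: $f\le g$ iff $\underline{f}(x)\le\underline{g}(x)$ and $\overline{f}(x)\le\overline{g}(x)$ for all $x\in X$. For a filter $\mathcal{F}$ on $\mathcal{M}(X,\mathbb{R})$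 let $\mathcal{F}^-=\{\phi\in\mathcal{M}(X,\mathbb{R}):\exists F\in\mathcal{F}\ \forall h\in F\ \phi\le h\}$ and $\mathcal{F}^+=\{\psi\in\mathcal{M}(X,\mathbb{R}):\exists F\in\mathcal{F}\ \forall h\in F\ \psi\ge h\}$. $\mathcal{F}$ order converges to $f$ if $\mathcal{F}^-\ne\emptyset$, $\mathcal{F}^+\ne\emptyset$ and $f=\sup\mathcal{F}^-=\inf\mathcal{F}^+$, where the supremum and infimum are taken in the partially ordered set $\mathcal{M}(X,\mathbb{R})$. *)

(* Defs.v *)
From HB Require Import structures.
From mathcomp Require Import all_boot all_order all_algebra.
From mathcomp Require Import all_classical all_reals all_analysis.

Set Implicit Arguments.
Unset Strict Implicit.
Unset Printing Implicit Defensive.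

Import Order.TTheory GRing.Theory Num.Theory.
Import numFieldNormedType.Exports.

Local Open Scope classical_set_scope.
Local Open Scope ring_scope.

(** * Minimal usco maps *)

Section Usco.
Context {R : realType} {X : topologicalType}.
Implicit Types g h : X -> set R.

Definition usco g : Prop :=
  (forall x, g x !=set0 /\ compact (g x)) /\
  (forall U : set R, open U -> open [set x | g x `<=` U]).

Definition submap h g : Prop := forall x, h x `<=` g x.

Definition minimal_usco g : Prop :=
  usco g /\ forall h, usco h -> submap h g -> h = g.

End Usco.

Record minusco (X : topologicalType) (R : realType) : Type := Minusco {
  minusco_map :> X -> set R;
  minusco_minimal : minimal_usco minusco_map }.

HB.instance Definition _ (X : topologicalType) (R : realType) :=
  gen_eqMixin (minusco X R).
HB.instance Definition _ (X : topologicalType) (R : realType) :=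
  gen_choiceMixin (minusco X R).

(** * The partial order *)

(* The least and greatest elements of [A], with junk value [0] when there is
   none; on the values of a usco map they exist, see [set_minP], [set_maxP]. *)
Definition set_min {R : realType} (A : set R) : R := xget 0 (A `&` lbound A).
Definition set_max {R : realType} (A : set R) : R := xget 0 (A `&` ubound A).

Lemma set_minP {R : realType} (A : set R) :
  A !=set0 -> compact A -> A (set_min A) /\ lbound A (set_min A).
Proof.
move=> A0 cA; rewrite /set_min; case: xgetP => [x _ [Ax lx]//|noA].
have [|c] := @compact_EVT_min R R id A A0 cA.
  by apply: continuous_subspaceT => x; exact: cvg_id.
rewrite inE => Ac minc; case: (noA c); split=> // t At.
by apply: minc; rewrite inE.
Qed.

Lemma set_maxP {R : realType} (A : set R) :
  A !=set0 -> compact A -> A (set_max A) /\ ubound A (set_max A).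
Proof.
move=> A0 cA; rewrite /set_max; case: xgetP => [x _ [Ax lx]//|noA].
have [|c] := @compact_EVT_max R R id A A0 cA.
  by apply: continuous_subspaceT => x; exact: cvg_id.
rewrite inE => Ac maxc; case: (noA c); split=> // t At.
by apply: maxc; rewrite inE.
Qed.

Section Selection.
Context {R : realType} {X : topologicalType}.
Implicit Types (g h : X -> set R) (s : X -> R).

(* The map whose graph is the closure in [X * R] of the graph of [s]. *)
Definition graph_closure s : X -> set R :=
  fun x => [set y | closure [set p : X * R | p.2 = s p.1] (x, y)].

Lemma usco_graph_closed g : usco g -> closed [set p : X * R | g p.1 p.2].
Proof.
move=> [cg og] [x y] clxy /=; apply: contrapT => ngxy.
have [e /= e0 be] : nbhs_ball y (~` g x).
  apply/nbhs_ballP; apply: open_nbhs_nbhs; split => //; apply: closed_openC.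
  by apply: compact_closed (cg x).2; exact: Rhausdorff.
pose U := [set z : R | e / 2 < `|y - z|].
have oU : open U.
  apply: (@open_comp _ _ (fun z => `|y - z|) [set t | e / 2 < t]).
    by move=> z _; apply: cvg_norm; apply: cvgB; [exact: cvg_cst|exact: cvg_id].
  exact: open_gt.
have [|[a b] [/= gab [gaU yb]]] :=
    clxy ([set a | g a `<=` U] `*` ball y (e / 2)).
  exists ([set a | g a `<=` U], ball y (e / 2)) => //=; split.
    apply: open_nbhs_nbhs; split; first exact: og.
    move=> z gxz; rewrite /U /= ltNge; apply/negP => yz.
    apply: be gxz; rewrite /ball /=; apply: le_lt_trans yz _.
    by rewrite ltr_pdivrMr// ltr_pMr// ltr1n.
  by apply: nbhsx_ballx; rewrite divr_gt0.
move: (gaU _ gab) yb; rewrite /U /ball /= => h1 h2.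
by have := lt_trans h1 h2; rewrite ltxx.
Qed.

Lemma closed_submap_usco g h : usco g -> submap h g ->
  (forall x, h x !=set0) -> closed [set p : X * R | h p.1 p.2] -> usco h.
Proof.
move=> [cg og] hg h0 ch; split=> [x|U oU].
  split; first exact: h0.
  apply: subclosed_compact (cg x).2 (hg x).
  suff cx : continuous (fun y : R => (x, y)).
    exact: (@preimage_closed _ _ (fun y : R => (x, y)) _ (in1W cx) ch).
  by move=> y; apply: (cvg_pair (F := nbhs y) (cvg_cst x) cvg_id).
rewrite openE => x0 hU; rewrite /interior.
pose P (i : X * R) (y : R) := forall y', `|y - y'| < i.2 -> h i.1 y' -> U y'.
have cov : \forall i \near filter_prod (nbhs x0) (nbhs (0 : R)^'+),
    g x0 `<=` P i.
  have /compact_near_coveringP ncov := (cg x0).2.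
  apply: ncov => y gy.
  have [V [W [nV /nbhs_ballP[d /= d0 dW] VW]]] : exists V W,
      [/\ nbhs x0 V, nbhs y W & forall a b, V a -> W b -> h a b -> U b].
    have [Uy|nUy] := pselect (U y).
      exists setT, U; split=> //; first exact: filterT.
      exact: open_nbhs_nbhs.
    have nh : ~ h x0 y by move=> /hU.
    have : nbhs (x0, y) (~` [set p : X * R | h p.1 p.2]).
      by apply: open_nbhs_nbhs; split => //; exact: closed_openC.
    move=> [[V W] /= [nV nW] VW]; exists V, W; split=> //.
    by move=> a b Va Wb hab; have := VW (a, b) (conj Va Wb).
  have d2 : 0 < d / 2 by rewrite divr_gt0.
  exists (ball y (d / 2), V `*` [set t | t < d / 2]) => /=.
    split; first exact: nbhsx_ballx.
    exists (V, [set t | t < d / 2]) => //=; split=> //.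
    by apply: nbhs_right_lt.
  move=> [z [a t]] /= [yz [Va td]] y' zy' hay'; apply: (VW a) => //.
  apply: dW; rewrite /ball /=; rewrite (splitr d).
  rewrite -(subrKA z); apply: le_lt_trans (ler_normD _ _) _.
  by apply: ltrD => //; apply: lt_trans zy' td.
case: cov => -[V T] /= [nV nT] VT.
have [e [e0 Te]] : exists e : R, 0 < e /\ T e.
  have : \forall e \near (0 : R)^'+, 0 < e /\ T e.
    by apply: filterI => //; exact: nbhs_right_gt.
  by move=> /filter_ex.
pose N := [set z : R | exists2 y, g x0 y & `|y - z| < e].
have oN : open N.
  have -> : N = \bigcup_(y in g x0) ball y e by [].
  by apply: bigcup_open => y _; exact: ball_open.
have : nbhs x0 (V `&` [set x | g x `<=` N]).
  apply: filterI => //; apply: open_nbhs_nbhs; split; first exact: og.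
  by move=> y gy; exists y => //; rewrite subrr normr0.
apply: filterS => x [Vx gN] z hz.
have [y gy yz] := gN _ (hg _ _ hz).
exact: (VT (x, e) (conj Vx Te) y gy z yz hz).
Qed.

Lemma minimal_usco_graph_closure g s :
  minimal_usco g -> (forall x, g x (s x)) -> graph_closure s = g.
Proof.
move=> [ug ming] gs.
have sub : submap (graph_closure s) g.
  move=> x y cy; apply: (usco_graph_closed ug (t := (x, y))).
  by apply: closure_subset cy => -[a b]/= ->.
apply: ming => //; apply: closed_submap_usco ug sub _ _.
  by move=> x; exists (s x); exact: subset_closure.
have -> : [set p : X * R | graph_closure s p.1 p.2] =
    closure [set p : X * R | p.2 = s p.1] by apply/seteqP; split=> -[].
exact: closed_closure.
Qed.

End Selection.

Section Order.
Context {X : topologicalType} {R : realType}.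
Implicit Types f g h : minusco X R.

Definition minusco_le f g : bool :=
  `[< forall x, set_min (f x) <= set_min (g x) /\
                set_max (f x) <= set_max (g x) >].

Lemma minusco_le_refl : reflexive minusco_le.
Proof. by move=> f; apply/asboolP => x; split. Qed.

Lemma minusco_le_trans : transitive minusco_le.
Proof.
move=> g f h /asboolP fg /asboolP gh; apply/asboolP => x.
have [fg1 fg2] := fg x; have [gh1 gh2] := gh x.
by split; [exact: le_trans fg1 gh1|exact: le_trans fg2 gh2].
Qed.

Lemma minusco_ext f g : minusco_map f = minusco_map g -> f = g.
Proof.
case: f g => [f mf] [g mg] /= fg; move: mf mg; rewrite fg => mf mg.
by congr Minusco; exact: Prop_irrelevance.
Qed.

Lemma minusco_le_anti : antisymmetric minusco_le.
Proof.
move=> f g /andP[/asboolP fg /asboolP gf]; apply: minusco_ext.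
have sel h x : h x (set_min (h x)).
  by have [[hx _] _] := minusco_minimal h; have [] := hx x => h0 /(set_minP h0)[].
rewrite -(minimal_usco_graph_closure (minusco_minimal f) (sel f)).
rewrite -(minimal_usco_graph_closure (minusco_minimal g) (sel g)).
congr graph_closure; apply/funext => x; apply: le_anti.
by rewrite (fg x).1 (gf x).1.
Qed.

End Order.

Fact minusco_display : Order.disp_t. Proof. exact: Order.Disp tt tt. Qed.

HB.instance Definition _ (X : topologicalType) (R : realType) :=
  Order.Le_isPOrder.Build minusco_display (minusco X R)
    (@minusco_le_refl X R) (@minusco_le_anti X R) (@minusco_le_trans X R).

(** * Convergence of filters *)

Section Convergence.
Context {X : topologicalType} {R : realType}.
Implicit Types (f : minusco X R) (g : X -> set R)
  (F : set_system (minusco X R)).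

Definition bracket g : set (minusco X R) := [set f | submap f g].

(* A limit requires some usco [g] with [bracket g] in the filter: an empty
   intersection does not count. *)
Definition lambda f : set (set_system (minusco X R)) :=
  [set F | ProperFilter F /\
    (exists g, usco g /\ F (bracket g)) /\
    [set f] = \bigcap_(g in [set g | usco g /\ F (bracket g)]) bracket g].

Definition filter_lower F : set (minusco X R) :=
  [set phi | exists2 A, F A & forall h, A h -> (phi <= h)%O].

Definition filter_upper F : set (minusco X R) :=
  [set psi | exists2 A, F A & forall h, A h -> (h <= psi)%O].

(* By antisymmetry [supremums A] and [infimums A] have at most one element. *)
Definition order_converges F f : Prop :=
  [/\ filter_lower F !=set0, filter_upper F !=set0,
      supremums (filter_lower F) f & infimums (filter_upper F) f].

End Convergence.

(* Main.v *)
(* Two facts about minimal usco maps drive the proof. First, if [phi <= m]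
   fails, then [phi > t > m] on some nonempty open set, for some constant [t].
   Second, a minimal usco map can be replaced by a constant on an open set, the
   result being controlled elsewhere by the original map.

   If F order converges to [f], the maps [min phi, max psi], with [phi] in F^-
   and [psi] in F^+, force any point of the intersection of the brackets to be
   [f]. If some [bracket g] in F missed [f], then on a nonempty open set W the
   values of [f] would lie in a gap ]a, b[ avoided by [g]; since members of
   [bracket g] jump over the gap, every element of F^- stays below [a] on W, so
   lowering [f] to [a] on W yields an upper bound of F^- not above [f].

   Conversely, suppose that the brackets in F intersect in [f] and that [m] is
   an upper bound of F^- with [f > t > m] on W. If all [g] with [bracket g] in
   F met ]-oo, t] throughout W, the intersection of their truncations would be
   usco and would contain a minimal usco map other than [f]. So some [g] lies
   above [t] on a nonempty open subset of W, where a lower bound of the filter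
   can be raised to [t], contradicting the choice of [m]. The statement on
   infima follows by applying this to the opposite maps. *)
Require Import Defs.
From mathcomp Require Import all_boot all_order all_algebra.
From mathcomp Require Import all_classical all_reals all_analysis.

Set Implicit Arguments.
Unset Strict Implicit.
Unset Printing Implicit Defensive.

Import Order.TTheory GRing.Theory Num.Theory.
Import numFieldNormedType.Exports.

Local Open Scope classical_set_scope.
Local Open Scope ring_scope.

(** * Intersections, minimal submaps and quasicontinuity of usco maps *)

Section UscoMaps.
Context {R : realType} {X : topologicalType}.
Implicit Types (g h : X -> set R) (G : set (X -> set R)).

(** By directedness the compact sets [g x] form a filter base; a cluster point of it lies in every
    one of them because they are closed. *)
Lemma usco_directed_bigcap G : G !=set0 -> (forall g, G g -> usco g) ->
  (forall g1 g2, G g1 -> G g2 ->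
    exists2 g, G g & submap g g1 /\ submap g g2) ->
  usco (fun x => \bigcap_(g in G) g x).
Proof.
move=> [g0 Gg0] Gu Gd; apply: (closed_submap_usco (Gu _ Gg0)).
- by move=> x y; apply.
- move=> x; pose B := filter_from G (fun g => g x).
  have PB : ProperFilter B.
    apply: filter_from_proper; last by move=> g /Gu[/(_ x)[]].
    apply: filter_from_filter; first by exists g0.
    move=> g1 g2 G1 G2; have [g Gg [g01 g02]] := Gd _ _ G1 G2.
    by exists g => // y gy; split; [exact: g01|exact: g02].
  have [|y [_ cy]] := ((Gu _ Gg0).1 x).2 B PB; first by exists g0.
  exists y => g Gg.
  have /closure_id -> : closed (g x).
    by apply: compact_closed ((Gu _ Gg).1 x).2; exact: Rhausdorff.
  by move=> V nV; apply: cy nV; exists g.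
- have -> : [set p : X * R | (\bigcap_(g in G) g p.1) p.2] =
     \bigcap_(g in G) [set p | g p.1 p.2] by [].
  by apply: closed_bigI => g /Gu /usco_graph_closed.
Qed.

(** Zorn's lemma on the usco submaps of [g], ordered by reverse inclusion: a nonempty chain is
    bounded by its intersection. *)
Lemma exists_minusco g : usco g -> exists m : minusco X R, submap m g.
Proof.
move=> ug; pose T := {h : X -> set R | usco h /\ submap h g}.
pose le (h k : T) := `[< submap (sval k) (sval h) >].
have [|h k l /asboolP hk /asboolP kl|h k /asboolP hk /asboolP kh|C totC|] :=
    @Zorn T le.
- by move=> h; apply/asboolP => x.
- by apply/asboolP => x y /kl /hk.
- apply: eq_sig_hprop => [*|]; first exact: Prop_irrelevance.
  apply/funext => x; apply/seteqP.
  by split; [exact: kh|exact: hk].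
- have [C0|/set0P C0] := eqVneq C set0.
    by exists (exist _ g (conj ug (fun _ _ => id))) => s; rewrite C0.
  pose m x := \bigcap_(h in sval @` C) h x.
  have um : usco m.
    apply: usco_directed_bigcap; first by case: C0 => h Ch; exists (sval h), h.
      by move=> _ [h Ch <-]; exact: (svalP h).1.
    move=> _ _ [h Ch <-] [k Ck <-].
    have [/asboolP hk|/asboolP kh] := totC _ _ Ch Ck.
      by exists (sval k); [exists k|split => // x].
    by exists (sval h); [exists h|split => // x].
  have mg : submap m g.
    by case: C0 => h Ch x y my; apply: (svalP h).2; apply: my; exists h.
  exists (exist _ m (conj um mg)) => h Ch; apply/asboolP => x y my.
  by apply: my; exists h.
move=> [m [um mg]] max.
have mm : minimal_usco m.
  split=> // h uh hm.
  have hg : submap h g by move=> x y /hm /mg.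
  have : le (exist _ m (conj um mg)) (exist _ h (conj uh hg)) by apply/asboolP.
  by move=> /max [].
by exists (Minusco mm).
Qed.

Lemma closed_off_open (U : set X) (V : set R) : open U -> open V ->
  closed [set p : X * R | U p.1 -> ~ V p.2].
Proof.
move=> oU oV.
have -> : [set p : X * R | U p.1 -> ~ V p.2] = ~` (fst @^-1` U `&` snd @^-1` V).
  by apply/seteqP; split => p /= h; [case=> /h|move=> Up Vp; apply: h].
apply: open_closedC; apply: openI; apply: open_comp => // p _.
  exact: cvg_fst.
exact: cvg_snd.
Qed.

Lemma usco_off_open g (U : set X) (V : set R) : usco g -> open U -> open V ->
  (forall x, exists2 y, g x y & U x -> ~ V y) ->
  usco (fun x => [set y | g x y /\ (U x -> ~ V y)]).
Proof.
move=> ug oU oV g0; apply: (closed_submap_usco ug).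
- by move=> x y [].
- by move=> x; have [y] := g0 x; exists y.
- by apply: closedI; [exact: usco_graph_closed|exact: closed_off_open].
Qed.

(** Otherwise deleting [V] over [U] would leave every value nonempty and give a usco submap of [g],
    a proper one since [g x] meets [V]. *)
Lemma minimal_usco_quasicontinuous g (U : set X) (V : set R) x :
  minimal_usco g -> open U -> open V -> U x -> g x `&` V !=set0 ->
  exists2 x', U x' & g x' `<=` V.
Proof.
move=> [ug ming] oU oV Ux [y [gy Vy]]; apply: contrapT => nW.
suff : usco (fun x => [set y | g x y /\ (U x -> ~ V y)]).
  move=> /ming h; have : g x y by [].
  by rewrite -h => [[_ /(_ Ux)]|z w []].
apply: usco_off_open => // z; have [w gw] := (ug.1 z).1.
have [Uz|nUz] := pselect (U z); last by exists w.
apply: contrapT => nz; apply: nW; exists z => // v gv.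
by apply: contrapT => nVv; apply: nz; exists v.
Qed.

End UscoMaps.

(** * Order and surgery on minimal usco maps *)

Section Minusco.
Context {X : topologicalType} {R : realType}.
Implicit Types (f h m phi psi : minusco X R) (g : X -> set R).

Lemma minusco_usco f : usco f. Proof. by case: (minusco_minimal f). Qed.

Lemma minusco_neq0 f x : f x !=set0.
Proof. exact: ((minusco_usco f).1 x).1. Qed.

Lemma usco_minP g x : usco g ->
  g x (set_min (g x)) /\ lbound (g x) (set_min (g x)).
Proof. by move=> [/(_ x)[g0 cg] _]; exact: set_minP. Qed.

Lemma usco_maxP g x : usco g ->
  g x (set_max (g x)) /\ ubound (g x) (set_max (g x)).
Proof. by move=> [/(_ x)[g0 cg] _]; exact: set_maxP. Qed.

Lemma minusco_le_lower phi m x y : (phi <= m)%O -> m x y ->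
  exists2 z, phi x z & z <= y.
Proof.
move=> /asboolP /(_ x)[le _] my.
have [mphi _] := usco_minP x (minusco_usco phi).
exists (set_min (phi x)) => //; apply: le_trans le _.
exact: (usco_minP x (minusco_usco m)).2.
Qed.

Lemma minusco_le_upper phi m x y : (phi <= m)%O -> phi x y ->
  exists2 z, m x z & y <= z.
Proof.
move=> /asboolP /(_ x)[_ le] my.
have [mm _] := usco_maxP x (minusco_usco m).
exists (set_max (m x)) => //; apply: le_trans le.
exact: (usco_maxP x (minusco_usco phi)).2.
Qed.

(** Take [t] midway between the two minima, or the two maxima, in the wrong order at a point.
    Semicontinuity keeps one map on its side of [t] nearby, and quasicontinuity brings the other to
    its side at some nearby point; both conditions are open. *)
Lemma minusco_nle_sep phi m : ~ (phi <= m)%O ->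
  exists t : R, exists W : set X, [/\ open W, W !=set0,
    forall x y, W x -> phi x y -> t < y & forall x y, W x -> m x y -> y < t].
Proof.
move=> nle.
have sep (t : R) : [set x | phi x `<=` [set y | t < y]] `&`
    [set x | m x `<=` [set y | y < t]] !=set0 ->
  exists t : R, exists W : set X, [/\ open W, W !=set0,
    forall x y, W x -> phi x y -> t < y & forall x y, W x -> m x y -> y < t].
  move=> W0; exists t; eexists; split; [|exact: W0| |].
  - apply: openI; apply: (minusco_usco _).2; [exact: open_gt|exact: open_lt].
  - by move=> x y [+ _]; apply.
  - by move=> x y [_]; apply.
have /asboolPn/existsNP[x] : ~~ minusco_le phi m by apply/negP.
move=> /not_andP[|] /negP; rewrite -ltNge => /midf_lt [];
  set t := (_ / _) => l1 l2; apply: (sep t).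
- have [] := @minimal_usco_quasicontinuous R X m
    [set x | phi x `<=` [set y | t < y]] [set y | y < t] x (minusco_minimal m).
  + by apply: (minusco_usco _).2; exact: open_gt.
  + exact: open_lt.
  + by move=> y /(usco_minP x (minusco_usco phi)).2 /=; exact: lt_le_trans.
  + exists (set_min (m x)); split => //.
    exact: (usco_minP x (minusco_usco m)).1.
  + by move=> x' h1 h2; exists x'.
- have [] := @minimal_usco_quasicontinuous R X phi
    [set x | m x `<=` [set y | y < t]] [set y | t < y] x (minusco_minimal phi).
  + by apply: (minusco_usco _).2; exact: open_lt.
  + exact: open_gt.
  + move=> y /(usco_maxP x (minusco_usco m)).2 /= h; exact: le_lt_trans h _.
  + exists (set_max (phi x)); split => //.
    exact: (usco_maxP x (minusco_usco phi)).1.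
  + by move=> x' h1 h2; exists x'.
Qed.

(** Provides the compact-valued envelope in which [minusco_patch] cuts out a closed graph. *)
Lemma usco_setU1 g c : usco g -> usco (fun x => g x `|` [set c]).
Proof.
move=> ug; split=> [x|U oU].
  split; first by exists c; right.
  by apply: compactU; [exact: (ug.1 x).2|exact: compact_set1].
have [Uc|nUc] := pselect (U c).
  have -> : [set x | g x `|` [set c] `<=` U] = [set x | g x `<=` U].
    apply/seteqP; split => x /= h; first by move=> y gy; apply: h; left.
    by move=> y [/h|->].
  exact: ug.2.
have -> : [set x | g x `|` [set c] `<=` U] = set0.
  by rewrite -subset0 => x /= h; apply: nUc; apply: h; right.
exact: open0.
Qed.

(** The boundary of [W] does not affect the comparisons: a failure of the order occurs on a nonempty
    open set, which either meets [W], where [m] is [c], or misses [closure W], where [m] is a submap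
    of [f]. *)
Lemma minusco_patch f (W : set X) (c : R) : open W ->
  exists m, [/\ forall x, W x -> m x = [set c],
    forall h, (f <= h)%O -> (forall x y, W x -> h x y -> c <= y) -> (m <= h)%O &
    forall h, (h <= f)%O -> (forall x y, W x -> h x y -> y <= c) -> (h <= m)%O].
Proof.
move=> oW.
(* This is [[set c]] on [W], [f] off [closure W], and [f x] with [c] added on the boundary, which
   closes the graph. *)
pose g x := [set y | (f x y \/ (closure W x /\ y = c)) /\
                     (W x -> ~ (~` [set c]) y)].
have ug : usco g.
  apply: (closed_submap_usco (usco_setU1 c (minusco_usco f))).
  - by move=> x y [[fy|[_ ->]] _]; [left|right].
  - move=> x; have [Wx|nWx] := pselect (W x).
      by exists c; split; [right; split=> //; exact: subset_closure|move=> _ /=].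
    by have [y fy] := minusco_neq0 f x; exists y; split; [left|].
  - apply: (@closedI _ [set p : X * R |
      f p.1 p.2 \/ (closure W p.1 /\ p.2 = c)]); last first.
      by apply: closed_off_open => //; apply: closed_openC; exact: closed_eq.
    apply: (@closedU _ [set p : X * R | f p.1 p.2]).
      exact: (usco_graph_closed (minusco_usco f)).
    apply: (@closedI _ (fst @^-1` closure W) (snd @^-1` [set c]));
      apply: preimage_closed.
    + by move=> p _; exact: cvg_fst.
    + exact: closed_closure.
    + by move=> p _; exact: cvg_snd.
    + exact: closed_eq.
have [m mg] := exists_minusco ug.
have mW x : W x -> m x = [set c].
  move=> Wx; have mc y : m x y -> y = c by move=> /mg[_ /(_ Wx) /contrapT].
  apply/seteqP; split=> y; first exact: mc.
  by move=> ->; have [z mz] := minusco_neq0 m x; rewrite -(mc z mz).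
have mf (V : set X) x y : open V -> V `&` W = set0 -> V x -> m x y -> f x y.
  move=> oV VW Vx /mg[[//|[clW _]] _].
  have [z [Wz Vz]] := clW V (open_nbhs_nbhs (conj oV Vx)).
  by suff : (V `&` W) z by rewrite VW.
exists m; split=> // h fh hc; apply: contrapT => /minusco_nle_sep.
- move=> [t [V [oV [x0 Vx0] mt ht]]].
  have [VW|/set0P[x [Vx Wx]]] := eqVneq (V `&` W) set0.
    have [y my] := minusco_neq0 m x0.
    have [z hz yz] := minusco_le_upper fh (mf _ _ _ oV VW Vx0 my).
    by have := lt_trans (ht _ _ Vx0 hz) (mt _ _ Vx0 my); rewrite ltNge yz.
  have [y hy] := minusco_neq0 h x.
  have tc : t < c by apply: (mt x) => //; rewrite mW.
  by have := lt_trans (ht _ _ Vx hy) tc; rewrite ltNge (hc x).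
- move=> [t [V [oV [x0 Vx0] ht mt]]].
  have [VW|/set0P[x [Vx Wx]]] := eqVneq (V `&` W) set0.
    have [y my] := minusco_neq0 m x0.
    have [z hz yz] := minusco_le_lower fh (mf _ _ _ oV VW Vx0 my).
    by have := lt_trans (mt _ _ Vx0 my) (ht _ _ Vx0 hz); rewrite ltNge yz.
  have [y hy] := minusco_neq0 h x.
  have tc : c < t by apply: (mt x) => //; rewrite mW.
  by have := lt_trans tc (ht _ _ Vx hy); rewrite ltNge (hc x).
Qed.

(** Any minimal map inside the closure of the graph of the pointwise minimum of [g] will do: its
    values are approached by those minima, which no [h] in the bracket undercuts. *)
Lemma bracket_lower_bound g : usco g ->
  exists phi, forall h, bracket g h -> (phi <= h)%O.
Proof.
move=> ug; pose s x := set_min (g x).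
have ucl : usco (graph_closure s).
  apply: (closed_submap_usco ug).
  - move=> x y cy; apply: (usco_graph_closed ug (t := (x, y))).
    by apply: closureS cy => -[a b]/= ->; exact: (usco_minP a ug).1.
  - by move=> x; exists (s x); exact: subset_closure.
  - have -> : [set p : X * R | graph_closure s p.1 p.2] =
        closure [set p : X * R | p.2 = s p.1] by apply/seteqP; split=> -[].
    exact: closed_closure.
have [phi phis] := exists_minusco ucl; exists phi => h hg.
apply: contrapT => /minusco_nle_sep[t [W [oW [x Wx] pt ht]]].
have [y py] := minusco_neq0 phi x.
have [|[a b] [/= -> [Wa /= ta]]] := phis _ _ py (W `*` [set z | t < z]).
  exists (W, [set z | t < z]) => //=.
  split; apply: open_nbhs_nbhs; split => //; exact: pt py.
have [z hz] := minusco_neq0 h a.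
have := (usco_minP a ug).2 _ (hg _ _ hz); rewrite leNgt => /negP; apply.
exact: lt_trans (ht _ _ Wa hz) ta.
Qed.

(** The lower end is lower semicontinuous and the upper end upper semicontinuous, so near a point
    the interval outgrows its value there by arbitrarily little. *)
Lemma usco_itv phi psi : (phi <= psi)%O ->
  usco (fun x => `[set_min (phi x), set_max (psi x)]%classic).
Proof.
move=> le.
have le' x : set_min (phi x) <= set_max (psi x).
  have [z pz yz] := minusco_le_upper le (usco_minP x (minusco_usco phi)).1.
  exact: le_trans yz ((usco_maxP x (minusco_usco psi)).2 _ pz).
split=> [x|U oU].
  split; last exact: segment_compact.
  by exists (set_min (phi x)); rewrite /= in_itv /= lexx le'.
rewrite openE => x gU; rewrite /interior.
set a := set_min (phi x) in gU; set b := set_max (psi x) in gU.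
have ball_in c : `[a, b]%classic c -> exists2 e, 0 < e & ball c e `<=` U.
  move=> /gU Uc.
  by have /nbhs_ballP[e /= e0 eU] := open_nbhs_nbhs (conj oU Uc); exists e.
have [d d0 dU] : exists2 e, 0 < e & ball a e `<=` U.
  by apply: ball_in; rewrite /= in_itv /= lexx le'.
have [e e0 eU] : exists2 e, 0 < e & ball b e `<=` U.
  by apply: ball_in; rewrite /= in_itv /= lexx le'.
have [Uphi Upsi] := ((minusco_usco phi).2, (minusco_usco psi).2).
have : nbhs x ([set x | phi x `<=` [set y | a - d < y]] `&`
               [set x | psi x `<=` [set y | y < b + e]]).
  apply: filterI; apply: open_nbhs_nbhs; split.
  - by apply: Uphi; exact: open_gt.
  - move=> y /(usco_minP x (minusco_usco phi)).2 /=; apply: lt_le_trans.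
    by rewrite ltrBlDr ltrDl.
  - by apply: Upsi; exact: open_lt.
  - move=> y /(usco_maxP x (minusco_usco psi)).2 /= yb; apply: le_lt_trans yb _.
    by rewrite ltrDl.
apply: filterS => z [/= pz1 pz2] y /=; rewrite in_itv /= => /andP[ay yb].
have {}ay := lt_le_trans (pz1 _ (usco_minP z (minusco_usco phi)).1) ay.
have {}yb := le_lt_trans yb (pz2 _ (usco_maxP z (minusco_usco psi)).1).
have [ya|ya] := ltP y a.
  apply: dU; rewrite /ball /= gtr0_norm ?subr_gt0//.
  by rewrite ltrBlDr -ltrBlDl.
have [by'|by'] := ltP b y.
  apply: eU; rewrite /ball /= distrC gtr0_norm ?subr_gt0//.
  by rewrite ltrBlDl.
by apply: gU; rewrite /= in_itv /= ya by'.
Qed.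

End Minusco.

(** * Suprema of lower bounds and intersections of brackets *)

Section Convergence.
Context {X : topologicalType} {R : realType}.
Implicit Types (f h m phi psi : minusco X R) (g : X -> set R)
  (F : set_system (minusco X R)).

(** Trimming [V] over [U] discards no map that lies in both [A] and [bracket g]; such a map exists
    because the filter is proper, so the trimmed values stay nonempty. *)
Lemma bracket_off_open F g A (U : set X) (V : set R) : ProperFilter F ->
  usco g -> F (bracket g) -> F A -> open U -> open V ->
  (forall h x y, A h -> U x -> h x y -> ~ V y) ->
  exists g', [/\ usco g', F (bracket g') &
    forall x y, U x -> g' x y -> ~ V y].
Proof.
move=> FF ug Fg FA oU oV AUV; have FAg : F (A `&` bracket g) by exact: filterI.
exists (fun x => [set y | g x y /\ (U x -> ~ V y)]); split.
- apply: usco_off_open => // x; have [h [Ah hg]] := filter_ex FAg.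
  have [y hy] := minusco_neq0 h x; exists y; first exact: hg.
  by move=> Ux; exact: AUV hy.
- apply: filterS FAg => h [Ah hg] x y hy; split; first exact: hg.
  by move=> Ux; exact: AUV hy.
- by move=> x y Ux [_]; apply.
Qed.

Lemma lambda_supremums F f : ProperFilter F -> lambda f F ->
  filter_lower F !=set0 /\ supremums (filter_lower F) f.
Proof.
move=> FF [_ [[g0 [ug0 Fg0]] limf]].
have fin g : usco g -> F (bracket g) -> submap f g.
  move=> ug Fg; suff : [set f] f by rewrite limf => /(_ g (conj ug Fg)).
  by [].
have funiq m : (forall g, usco g -> F (bracket g) -> submap m g) -> m = f.
  move=> mg; suff : [set f] m by [].
  by rewrite limf => g [ug Fg]; exact: mg.
have [phi0 phi0P] := bracket_lower_bound ug0.
split; first by exists phi0; exists (bracket g0).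
split=> [phi [A FA phiA]|m mub]; apply: contrapT => /minusco_nle_sep.
  (* Members of [A] exceed [t] on [W], so some bracket in the filter avoids ]-oo, t[ there; [f]
     belongs to it but lies below [t] on [W]. *)
  move=> [t [W [oW [x Wx] pt ft]]].
  have [|g [ug Fg gW]] := bracket_off_open FF ug0 Fg0 FA oW (@open_lt R t).
    move=> h a y Ah Wa hy /= yt.
    have [z pz zy] := minusco_le_lower (phiA h Ah) hy.
    by have := lt_trans (pt _ _ Wa pz) (le_lt_trans zy yt); rewrite ltxx.
  have [y fy] := minusco_neq0 f x.
  by apply: (gW _ _ Wx (fin _ ug Fg _ _ fy)); exact: (ft x).
move=> [t [W [oW [x0 Wx0] ft mt]]].
pose V := [set y : R | t < y].
pose cut g x := [set y : R | g x y /\ (W x -> ~ V y)].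
pose G := cut @` [set g | usco g /\ F (bracket g)].
have [meets|] := pselect (forall g x, usco g -> F (bracket g) ->
    exists2 y, g x y & W x -> ~ V y).
  have uG g : G g -> usco g.
    move=> [g' [ug' Fg'] <-]; apply: usco_off_open => // x.
    exact: meets.
  have uH : usco (fun x => \bigcap_(g in G) g x).
    apply: usco_directed_bigcap => //; first by exists (cut g0), g0.
    move=> _ _ [g1 [ug1 Fg1] <-] [g2 [ug2 Fg2] <-].
    (* Pointwise intersections make the truncations directed; their values are nonempty because the
       two brackets have a common member. *)
    have FI : F (bracket g1 `&` bracket g2) by exact: filterI.
    have ug12 : usco (fun x => g1 x `&` g2 x).
      apply: (closed_submap_usco ug1) => [x y []//|x|].
        have [h [h1 h2]] := filter_ex FI; have [y hy] := minusco_neq0 h x.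
        by exists y; split; [exact: h1|exact: h2].
      exact: (closedI (usco_graph_closed ug1) (usco_graph_closed ug2)).
    exists (cut (fun x => g1 x `&` g2 x)).
      exists (fun x => g1 x `&` g2 x) => //; split => //.
      by apply: filterS FI => h [h1 h2] x y hy; split; [exact: h1|exact: h2].
    by split=> x y [[]].
  (* This minimal map lies in every bracket of the filter, so it equals [f], yet its values on [W]
     are at most [t]. *)
  have [m' m'H] := exists_minusco uH.
  have m'f : m' = f.
    apply: funiq => g ug Fg x y my.
    suff [] : cut g x y by [].
    by apply: (m'H _ _ my (cut g)); exists g.
  have [y fy] := minusco_neq0 f x0.
  have [_ /(_ Wx0)] : cut g0 x0 y.
    by rewrite -m'f in fy; apply: (m'H _ _ fy (cut g0)); exists g0.
  by apply; exact: (ft x0).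
(* The truncation of [g] is empty at [x]: so [x] lies in [W] and [g x] inside [V], which persists on
   an open set. *)
move=> /existsNP[g /existsNP[x]] /not_implyP[ug] /not_implyP[Fg ngx].
have Wx : W x.
  apply: contrapT => nWx; apply: ngx.
  by have [y gy] := (ug.1 x).1; exists y.
have gV : g x `<=` V.
  by move=> y gy; apply: contrapT => nVy; apply: ngx; exists y.
pose W' := W `&` [set x | g x `<=` V].
have oW' : open W' by apply: openI => //; apply: ug.2; exact: open_gt.
(* Raised to [t] on [W'], [phi0] still bounds from below all maps in both brackets, so [m] would
   have to reach [t] in [W]. *)
have [phi [phiW phile _]] := minusco_patch phi0 t oW'.
have phiF : filter_lower F phi.
  exists (bracket g0 `&` bracket g); first exact: filterI.
  move=> h [h0 hg]; apply: phile; first exact: phi0P.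
  by move=> a y [Wa gaV] hy; apply: ltW; apply: gaV; exact: hg.
have [|z mz tz] := @minusco_le_upper _ _ _ _ x t (mub _ phiF).
  by rewrite phiW.
by have := mt _ _ Wx mz; rewrite ltNge tz.
Qed.

Lemma order_converges_submap F f g : ProperFilter F ->
  supremums (filter_lower F) f -> usco g -> F (bracket g) -> submap f g.
Proof.
move=> FF [fub flub] ug Fg.
have [meets|] := pselect (forall x, f x `&` g x !=set0).
  (* The pointwise intersection is a usco submap of [f], hence [f] itself by minimality. *)
  have ufg : usco (fun x => f x `&` g x).
    apply: (closed_submap_usco ug) => [x y []//|//|].
    have uf := minusco_usco f.
    exact: (closedI (usco_graph_closed uf) (usco_graph_closed ug)).
  have fg := (minusco_minimal f).2 _ ufg (fun x y => @proj1 _ _).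
  by move=> x y; rewrite -fg => -[].
move=> /existsNP[x0 fg0]; exfalso.
have [y fy] := minusco_neq0 f x0.
have ngy : ~ g x0 y by move=> gy; apply: fg0; exists y.
have : nbhs (x0, y) (~` [set p : X * R | g p.1 p.2]).
  apply: open_nbhs_nbhs; split => //; apply: closed_openC.
  exact: usco_graph_closed.
move=> [[U B] /= [nU /nbhs_ballP[e /= e0 eB]] UB].
(* Half the radius puts the closed interval from [a] to [b] inside the ball avoided by [g],
   endpoints included. *)
have e2 : 0 < e / 2 by rewrite divr_gt0.
pose a := y - e / 2; pose b := y + e / 2.
have gab x z : U^° x -> g x z -> a <= z -> b < z.
  move=> Ux gz az; rewrite ltNge; apply/negP => zb.
  apply: (UB (x, z)) gz; split => /=; first exact: interior_subset.
  apply: eB; rewrite /ball /= ltr_distlC; apply/andP; split.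
    by apply: lt_le_trans az; rewrite ltrD2l ltrN2 ltr_pdivrMr// ltr_pMr// ltr1n.
  by apply: le_lt_trans zb _; rewrite ltrD2l ltr_pdivrMr// ltr_pMr// ltr1n.
have oab : open [set z : R | a < z < b].
  have -> : [set z : R | a < z < b] = [set z | a < z] `&` [set z | z < b].
    by apply/seteqP; split => z /=; [move=> /andP|move=> [-> ->]].
  by apply: openI; [exact: open_gt|exact: open_lt].
have [|x1 Ux1 fx1] := minimal_usco_quasicontinuous
    (minusco_minimal f) (@open_interior _ U) oab nU.
  by exists y; split => //=; rewrite ltrBlDr !ltrDl e2.
pose W := U^° `&` [set x | f x `<=` [set z : R | a < z < b]].
have oW : open W.
  by apply: openI; [exact: open_interior|exact: (minusco_usco f).2].
(* If [phi] exceeded [a] in [W], it would do so on an open subset, where the maps in [bracket g]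
   above [phi] jump past [b]. Raising [phi] to [b] there would give an element of F^- not below
   [f]. *)
have low phi x z : filter_lower F phi -> W x -> phi x z -> z <= a.
  move=> [A FA phiA] Wx phiz; rewrite leNgt; apply/negP => az.
  have [|x2 Wx2 phi2] := minimal_usco_quasicontinuous
      (minusco_minimal phi) oW (@open_gt R a) Wx; first by exists z.
  pose W' := W `&` [set x | phi x `<=` [set z : R | a < z]].
  have oW' : open W'.
    by apply: openI => //; apply: (minusco_usco phi).2; exact: open_gt.
  have [phi' [phi'W phi'le _]] := minusco_patch phi b oW'.
  have phi'F : filter_lower F phi'.
    exists (A `&` bracket g); first exact: filterI.
    move=> h [Ah hg]; apply: phi'le; first exact: phiA.
    move=> x' y' [[Ux' _] phia] hy'; apply/ltW/(gab x') => //; first exact: hg.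
    have [z' phiz' zy'] := minusco_le_lower (phiA _ Ah) hy'.
    by apply: ltW; apply: lt_le_trans zy'; exact: phia.
  have [|w fw bw] := @minusco_le_upper _ _ _ _ x2 b (fub _ phi'F).
    by rewrite phi'W.
  by have /andP[_] := Wx2.2 _ fw; rewrite ltNge bw.
have [f' [f'W _ lef']] := minusco_patch f a oW.
have ff' : (f <= f')%O.
  apply: flub => phi phiF; apply: lef'; first exact: fub.
  by move=> x z Wx; exact: low.
have [|w fw wa] := @minusco_le_lower _ _ _ _ x1 a ff'.
  by rewrite f'W.
by have /andP[] := fx1 _ fw; rewrite ltNge wa.
Qed.

Lemma order_converges_lambda F f : ProperFilter F ->
  order_converges F f -> lambda f F.
Proof.
move=> FF [[phi0 lphi0] [psi0 upsi0] supf inff].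
(* Maps between [phi] and [psi] take values in this interval, so its bracket is in the filter; a
   common member of [A] and [B] gives [phi <= psi]. *)
have itv phi psi : filter_lower F phi -> filter_upper F psi ->
    usco (fun x => `[set_min (phi x), set_max (psi x)]%classic) /\
    F (bracket (fun x => `[set_min (phi x), set_max (psi x)]%classic)).
  move=> [A FA phiA] [B FB psiB]; have FAB : F (A `&` B) by exact: filterI.
  split.
    have [h [Ah Bh]] := filter_ex FAB.
    by apply: usco_itv; exact: le_trans (phiA _ Ah) (psiB _ Bh).
  apply: filterS FAB => h [Ah Bh] x y hy; rewrite /= in_itv /=.
  have [z pz zy] := minusco_le_lower (phiA _ Ah) hy.
  have [w pw yw] := minusco_le_upper (psiB _ Bh) hy.
  apply/andP; split.
    by apply: le_trans zy; exact: (usco_minP x (minusco_usco phi)).2.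
  by apply: le_trans yw _; exact: (usco_maxP x (minusco_usco psi)).2.
split=> //; split; first by eexists; exact: itv lphi0 upsi0.
apply/seteqP; split=> [_ -> g [ug Fg]|h hlim].
  exact: order_converges_submap supf ug Fg.
(* Lying in every interval map makes [h] a lower bound of F^+ and an upper bound of F^-, since a
   failure would separate values strictly on an open set. *)
apply: le_anti; apply/andP; split.
  apply: inff.2 => psi upsi; apply: contrapT => /minusco_nle_sep.
  move=> [t [W [oW [x Wx] ht pt]]]; have [y hy] := minusco_neq0 h x.
  have := hlim _ (itv _ _ lphi0 upsi) _ _ hy; rewrite /= in_itv /= => /andP[_].
  rewrite leNgt => /negP; apply; apply: lt_trans (ht _ _ Wx hy).
  by apply: (pt x) => //; exact: (usco_maxP x (minusco_usco psi)).1.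
apply: supf.2 => phi lphi; apply: contrapT => /minusco_nle_sep.
move=> [t [W [oW [x Wx] pt ht]]]; have [y hy] := minusco_neq0 h x.
have := hlim _ (itv _ _ lphi upsi0) _ _ hy; rewrite /= in_itv /= => /andP[+ _].
rewrite leNgt => /negP; apply; apply: lt_trans (ht _ _ Wx hy) _.
by apply: (pt x) => //; exact: (usco_minP x (minusco_usco phi)).1.
Qed.

End Convergence.

(** * Negation of maps, exchanging suprema and infima *)

Section Opposite.
Context {X : topologicalType} {R : realType}.
Implicit Types (f h m : minusco X R) (g : X -> set R)
  (F : set_system (minusco X R)).

Definition oppmap g : X -> set R := fun x => [set y | g x (- y)].

Lemma oppmapK : involutive oppmap.
Proof.
move=> g; apply/funext => x; apply/seteqP.
by split=> y; rewrite /oppmap /= opprK.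
Qed.

Lemma oppmapS g g' : submap g g' -> submap (oppmap g) (oppmap g').
Proof. by move=> gg' x y /gg'. Qed.

Lemma usco_oppmap g : usco g -> usco (oppmap g).
Proof.
move=> [cg og]; have cN : continuous (fun y : R => - y).
  by move=> y; apply: cvgN; exact: cvg_id.
split=> [x|U oU].
  have -> : oppmap g x = -%R @` g x.
    apply/seteqP; split=> y /=; first by exists (- y); rewrite ?opprK.
    by case=> z gz <-; rewrite /oppmap /= opprK.
  have [[y gy] cgx] := cg x; split; first by exists (- y); exists y.
  by apply: continuous_compact cgx; exact: continuous_subspaceT.
have -> : [set x | oppmap g x `<=` U] = [set x | g x `<=` -%R @^-1` U].
  apply/seteqP; split=> x /= gU y gy; first by apply: gU; rewrite /oppmap /= opprK.
  by rewrite -(opprK y); exact: gU.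
by apply: og; apply: open_comp => // y _; exact: cN.
Qed.

Lemma minimal_usco_oppmap g : minimal_usco g -> minimal_usco (oppmap g).
Proof.
move=> [ug ming]; split; first exact: usco_oppmap.
move=> h uh /oppmapS; rewrite oppmapK => hg.
by rewrite -(oppmapK h) (ming _ (usco_oppmap uh) hg).
Qed.

Definition oppm f : minusco X R :=
  Minusco (minimal_usco_oppmap (minusco_minimal f)).

Lemma oppmK : involutive oppm.
Proof. by move=> f; apply: minusco_ext; exact: oppmapK. Qed.

(** Separation on an open set replaces computing the extrema of the reflected values. *)
Lemma le_oppm f h : (f <= h)%O -> (oppm h <= oppm f)%O.
Proof.
move=> fh; apply: contrapT => /minusco_nle_sep[t [W [_ [x Wx] ht ft]]].
have [y fy] := minusco_neq0 f x; have [z hz yz] := minusco_le_upper fh fy.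
have {}ht : t < - z by apply: (ht x) => //; rewrite /= /oppmap /= opprK.
have {}ft : - y < t by apply: (ft x) => //; rewrite /= /oppmap /= opprK.
by have := lt_trans ft ht; rewrite ltrN2 ltNge yz.
Qed.

Lemma oppm_bracket g : oppm @^-1` bracket g = bracket (oppmap g).
Proof.
by apply/seteqP; split=> h /= /oppmapS; rewrite ?oppmapK//= oppmapK.
Qed.

(** Negation is an involution carrying brackets to brackets, so it transports their intersection. *)
Lemma lambda_oppm F f : lambda f F -> lambda (oppm f) (oppm @ F).
Proof.
move=> [FF [[g0 [ug0 Fg0]] limf]]; split; first exact: fmap_proper_filter.
have opF g : F (bracket g) -> (oppm @ F) (bracket (oppmap g)).
  by rewrite /= /fmap /= oppm_bracket oppmapK.
split; first by exists (oppmap g0); split; [exact: usco_oppmap|exact: opF].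
apply/seteqP; split=> [_ -> g [ug Fg]|h hlim].
  have : [set f] f by [].
  rewrite limf => /(_ (oppmap g)) fg.
  rewrite -(oppmapK g); apply: oppmapS; apply: fg; split.
    exact: usco_oppmap.
  by rewrite -oppm_bracket.
suff <- : oppm h = f by rewrite oppmK.
suff : [set f] (oppm h) by [].
rewrite limf => g [ug Fg]; rewrite -(oppmapK g).
by apply: oppmapS; apply: hlim; split; [exact: usco_oppmap|exact: opF].
Qed.

Lemma filter_lower_oppm F h :
  filter_lower (oppm @ F) (oppm h) <-> filter_upper F h.
Proof.
split=> -[A FA hA].
  exists (oppm @^-1` A) => // k /hA /le_oppm; by rewrite !oppmK.
exists (oppm @^-1` A); last by move=> k /hA /le_oppm; rewrite oppmK.
have AE : A = oppm @^-1` (oppm @^-1` A).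
  by apply/funext => k; rewrite /preimage /= oppmK.
by rewrite AE in FA.
Qed.

(** Negation turns upper bounds of the filter into lower bounds of its image, to which
    [lambda_supremums] applies. *)
Lemma lambda_infimums F f : ProperFilter F -> lambda f F ->
  filter_upper F !=set0 /\ infimums (filter_upper F) f.
Proof.
move=> FF /lambda_oppm /lambda_supremums[[h Fh] [fub flub]].
split; first by exists (oppm h); apply/filter_lower_oppm; rewrite oppmK.
split=> [psi /filter_lower_oppm /fub /le_oppm|m mlb]; first by rewrite !oppmK.
rewrite -(oppmK f) -(oppmK m); apply/le_oppm/flub => phi Fphi.
rewrite -(oppmK phi); apply/le_oppm/mlb/filter_lower_oppm.
by rewrite oppmK.
Qed.

End Opposite.

Theorem theorem25 (R : realType) (X : topologicalType) (f : minusco X R)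
    (F : set_system (minusco X R)) (FF : ProperFilter F) :
  order_converges F f <-> lambda f F.
Proof.
split=> [|lf]; first exact: order_converges_lambda.
have [lF supf] := lambda_supremums FF lf.
by have [uF inff] := lambda_infimums FF lf.
Qed.
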